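(* Let $M\ge1$ be an integer and let $\Delta_1,\ldots,\Delta_M\ge 0$. The following two optimal values are equal: (i) the supremum of $J(\pi)$ over all history-dependent randomized policies $\pi\in\Pi^{\rm h}$ of the original system subject to $\mathbb{P}^{\pi}\big(|\{t\in\{0,\ldots,T\}:x_t\in\mathcal{X}_{\rm a}\}|\ge i\big)\le\Delta_i$ for all $i=1,\ldots,M$; (ii) the supremum of $J(\hat\pi)$ over all Markov randomized policies $\hat\pi\in\hat\Pi^{\rm m}$ of the system augmented with the alarm counter $\phi_t\in\{0,\ldots,M\}$ subject to $\mathbb{P}^{\hat\pi}(\phi_T\ge i)\le\Delta_i$ for all $i=1,\ldots,M$.
   Context: Original system. Let $T\ge1$ be an integer and let $\mathcal{X}\subset\mathbb{R}^n$, $\mathcal{A}\subset\mathbb{R}^m$, $\mathcal{W}\subset\mathbb{R}^\ell$ be nonempty Borel sets. The system is $x_{t+1}=f(x_t,a_t,w_t)$, $t=0,\ldots,T-1$, with $f:\mathcal{X}\times\mathcal{A}\times\mathcal{W}\to\mathcal{X}$ Borel measurable, state $x_t\in\mathcal{X}$, attack input $a_t\in\mathcal{A}$, and independent $\mathcal{W}$-valued random noises $w_t$ (also independent of $x_0$). The initial state has distribution $p_0$, and $p_{t+1}(dx_{t+1}|x_t,a_t)$ denotes the transition kernel induced by $f$ and the law of $w_t$. The alarm region is a Borel set $\mathcal{X}_{\rm a}\subset\mathcal{X}$; an alarm is triggered at time $t$ when $x_t\in\mathcal{X}_{\rm a}$. Policies. A history-dependent randomized policy of the original system is a tuple $\pi=(\pi_t)_{t=0}^{T-1}$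 of Borel stochastic kernels $\pi_t(da_t|x_{0:t},a_{0:t-1})$ on $\mathcal{A}$, where $x_{0:t}=(x_0,\ldots,x_t)$; the set of these is $\Pi^{\rm h}$. Such a $\pi$, with $p_0$ and the transition kernels, induces a unique probability measure $\mathbb{P}^\pi$ on trajectories $(x_0,a_0,x_1,\ldots,a_{T-1},x_T)$, with expectation $\mathbb{E}^\pi$. Augmented system. The augmented state is $(x_t,\phi_t)\in\mathcal{X}\times\{0,\ldots,M\}$: $\phi_0=1$ if $x_0\in\mathcal{X}_{\rm a}$ and $\phi_0=0$ otherwise; $x_{t+1}=f(x_t,a_t,w_t)$; $\phi_{t+1}=M$ if $\phi_t=M$; $\phi_{t+1}=\phi_t+1$ if $x_{t+1}\in\mathcal{X}_{\rm a}$ and $\phi_t<M$; and $\phi_{t+1}=\phi_t$ otherwise. $\hat\Pi^{\rm m}$ is the set of Markov randomized policies $\hat\pi=(\hat\pi_t)_{t=0}^{T-1}$, i.e. tuples of stochastic kernels $\hat\pi_t(da_t|x_t,\phi_t)$ on $\mathcal{A}$. $\mathbb{P}^{\hat\pi}$ and $\mathbb{E}^{\hat\pi}$ denote the induced probability measure on trajectories of the augmented system and its expectation. Objective. $J(\pi)=\mathbb{E}^\pi\big[\sum_{t=0}^{T-1}g_t(x_t,a_t)+g_T(x_T)\big]$ for $\pi\in\Pi^{\rm h}$, and $J(\hat\pi)$ is the same expression with $\mathbb{E}^{\hat\pi}$ for $\hat\pi\in\hat\Pi^{\rm m}$. Here $g_t:\mathcal{X}\times\mathcal{A}\to\mathbb{R}$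 ($t<T$) and $g_T:\mathcal{X}\to\mathbb{R}$ are Borel measurable and such that, for every policy, the sum over $t$ of the expectations of the positive parts of the terms or the sum over $t$ of the expectations of their negative parts is finite, so that $J$ is well defined in $[-\infty,\infty]$ and equals the sum of the expectations of the terms. The supremum over an empty feasible set is $-\infty$. *)

(* Defs.v *)
From HB Require Import structures.
From mathcomp Require Import all_boot all_order all_algebra.
From mathcomp Require Import all_classical all_reals all_analysis measurable_realfun.

Set Implicit Arguments.
Unset Strict Implicit.
Unset Printing Implicit Defensive.
Import Order.TTheory GRing.Theory Num.Theory.
Import numFieldNormedType.Exports.

Local Open Scope classical_set_scope.
Local Open Scope ring_scope.

(* R^n is n.-tuple R with the product sigma-algebra, which is the Borel
   sigma-algebra of R^n. *)
Record borelSet (R : realType) (n : nat) := BorelSet {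
  bset : set (n.-tuple R) ;
  bset_measurable : measurable bset ;
  bset_nonempty : bset !=set0 }.

(* The points of a nonempty Borel set, with the trace of the Borel
   sigma-algebra. *)
Definition borel_space (R : realType) (n : nat) (B : borelSet R n) : Type :=
  set_type (bset B).
Coercion borel_space : borelSet >-> Sortclass.

Definition borel_display : measure_display.
Proof. by constructor. Qed.

Section borel_space.
Context {R : realType} {n : nat} (B : borelSet R n).

Definition borel_val (x : B) : n.-tuple R := set_val x.

Definition borel_point : B :=
  let w := cid (bset_nonempty B) in SigSub (mem_set (projT2 w)).

HB.instance Definition _ := Choice.copy B (set_type (bset B)).
HB.instance Definition _ := isPointed.Build B borel_point.

Definition borel_trace : set (set B) :=
  preimage_set_system [set: B] borel_val measurable.

Let sigma_trace : sigma_algebra [set: B] borel_trace.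
Proof. exact/sigma_algebra_preimage/sigma_algebra_measurable. Qed.

Let trace0 : borel_trace set0.
Proof. by case: sigma_trace. Qed.

Let traceC U : borel_trace U -> borel_trace (~` U).
Proof. by case: sigma_trace => _ + _ => /[apply]; rewrite setTD. Qed.

Let trace_bigcup (F : (set B)^nat) :
  (forall i, borel_trace (F i)) -> borel_trace (\bigcup_i F i).
Proof. by case: sigma_trace => _ _; exact. Qed.

HB.instance Definition _ := @isMeasurable.Build borel_display B
  borel_trace trace0 traceC trace_bigcup.

End borel_space.

HB.instance Definition _ (n : nat) := isPointed.Build 'I_n.+1 ord0.
HB.instance Definition _ (n : nat) :=
  @isMeasurable.Build default_measure_display 'I_n.+1 discrete_measurable
    discrete_measurable0 discrete_measurableC discrete_measurableU.

Section kernel_constructions.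
Context {R : realType} {dX dY dZ : measure_display}.
Context {X : measurableType dX} {Y : measurableType dY}
  {Z : measurableType dZ}.

(* mu(dx) k(dy | x), as a probability on X * Y *)
Section semidirect.
Variables (mu : probability X R) (k : R.-pker X ~> Y).

Definition semidirect (U : set (X * Y)) : \bar R :=
  \int[mu]_x k x (xsection U x).

Let semidirect0 : semidirect set0 = 0%E.
Proof.
by apply: integral0_eq => x _; rewrite xsection0 measure0.
Qed.

Let semidirect_ge0 U : (0 <= semidirect U)%E.
Proof. exact: integral_ge0. Qed.

Let semidirect_sigma_additive : semi_sigma_additive semidirect.
Proof.
move=> F mF tF mUF; rewrite [X in _ --> X](_ : _ =
  (\int[mu]_x (\sum_(i <oo) k x (xsection (F i) x)))%E); last first.
  apply: eq_integral => x _; rewrite xsection_bigcup.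
  apply/esym/cvg_lim => //; apply: measure_semi_sigma_additive => //.
  - by move=> i; exact: measurable_xsection.
  - exact: trivIset_xsection.
  - by apply: bigcup_measurable => i _; exact: measurable_xsection.
apply/cvg_closeP; split.
  by apply: is_cvg_nneseries => i _ _; exact: integral_ge0.
rewrite closeE// integral_nneseries// => i.
by apply: measurable_fun_xsection_finite_kernel; rewrite inE.
Qed.

HB.instance Definition _ := isMeasure.Build _ _ R semidirect
  semidirect0 semidirect_ge0 semidirect_sigma_additive.

Let semidirectT : semidirect [set: X * Y] = 1%E.
Proof.
rewrite /semidirect (eq_integral (cst 1%E)); last first.
  by move=> x _; rewrite xsectionE preimage_setT prob_kernel.
by rewrite integral_cst//= mul1e; exact: probability_setT.
Qed.

HB.instance Definition _ :=
  Measure_isProbability.Build _ _ R semidirect semidirectT.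

End semidirect.

(* k(dz | f x) *)
Section kernel_precomp.
Variables (k : R.-pker Y ~> Z) (f : {mfun X >-> Y}).

Definition kprecomp (x : X) : {measure set Z -> \bar R} := k (f x).

Let measurable_kprecomp U : measurable U ->
  measurable_fun [set: X] (kprecomp ^~ U).
Proof.
move=> mU; have mk : measurable_fun [set: Y] (k ^~ U).
  exact: measurable_kernel.
exact: (measurableT_comp mk (measurable_funPT f)).
Qed.

HB.instance Definition _ := isKernel.Build _ _ X Z R kprecomp
  measurable_kprecomp.

Let kprecomp1 x : kprecomp x [set: Z] = 1%E.
Proof. exact: prob_kernel. Qed.

HB.instance Definition _ := Kernel_isProbability.Build _ _ X Z R kprecomp
  kprecomp1.

End kernel_precomp.

(* The law of f (x, w) when w has law nu *)
Section noise_kernel.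
Variables (nu : probability Y R) (f : {mfun (X * Y)%type >-> Z}).

Let f_at (x : X) (y : Y) : Z := f (x, y).

Let measurable_f_at x : measurable_fun [set: Y] (f_at x).
Proof. exact: (measurableT_comp (measurable_funPT f) (measurable_pair1 x)). Qed.

HB.instance Definition _ x :=
  isMeasurableFun.Build _ _ Y Z (f_at x) (measurable_f_at x).

Definition noise_kernel (x : X) : {measure set Z -> \bar R} :=
  distribution nu (f_at x).

Let measurable_noise_kernel U : measurable U ->
  measurable_fun [set: X] (noise_kernel ^~ U).
Proof.
move=> mU.
have mfU : measurable (f @^-1` U).
  by rewrite -[X in measurable X]setTI; exact: measurable_funPT.
have := measurable_fun_xsection nu mfU.
apply: eq_measurable_fun => x _ /=.
by rewrite /noise_kernel /distribution /pushforward /= xsectionE.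
Qed.

HB.instance Definition _ := isKernel.Build _ _ X Z R noise_kernel
  measurable_noise_kernel.

Let noise_kernel1 x : noise_kernel x [set: Z] = 1%E.
Proof. exact: probability_setT. Qed.

HB.instance Definition _ := Kernel_isProbability.Build _ _ X Z R noise_kernel
  noise_kernel1.

End noise_kernel.

End kernel_constructions.

(* x_{0:t} and a_{0:t-1} *)
Notation history S A t := (t.+1.-tuple S * t.-tuple A)%type.

Section controlled_system.
Context {R : realType} {dS dA : measure_display}.
Context {S : measurableType dS} {A : measurableType dA}.

Definition initial_history (x : S) : history S A 0 := ([tuple x], [tuple]).

Definition last_state t (h : history S A t) : S := tnth h.1 ord_max.

Definition last_pair t (z : history S A t * A) : S * A :=
  (last_state z.1, z.2).

Definition extend t (z : history S A t * A * S) : history S A t.+1 :=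
  ([tuple of rcons z.1.1.1 z.2], [tuple of rcons z.1.1.2 z.1.2]).

Let measurable_initial_history : measurable_fun setT initial_history.
Proof.
apply: measurable_fun_pair; apply/measurable_fun_tnthP => i; last by case: i.
by rewrite (_ : _ \o _ = id)//; apply/funext => x /=; rewrite (ord1 i).
Qed.

Let measurable_last_state t : measurable_fun setT (@last_state t).
Proof. exact: (measurableT_comp (measurable_tnth ord_max)). Qed.

Let measurable_last_pair t : measurable_fun setT (@last_pair t).
Proof.
apply: measurable_fun_pair => //.
exact: (measurableT_comp (@measurable_last_state t)).
Qed.

Let measurable_rcons d d' (U : measurableType d) (V : measurableType d') n
    (f : U -> n.-tuple V) (g : U -> V) :
  measurable_fun setT f -> measurable_fun setT g ->
  measurable_fun setT (fun u => [tuple of rcons (f u) (g u)]).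
Proof.
move=> mf mg; apply/measurable_fun_tnthP => i.
have [lt_in|le_ni] := ltnP i n.
  rewrite (_ : _ \o _ = fun u => tnth (f u) (Ordinal lt_in)).
    exact: (measurableT_comp (measurable_tnth _) mf).
  apply/funext => u /=.
  by rewrite !(tnth_nth (g u)) /= nth_rcons size_tuple lt_in.
rewrite (_ : _ \o _ = g)//; apply/funext => u /=.
rewrite (tnth_nth (g u)) /= nth_rcons size_tuple ltnNge le_ni /=.
by rewrite eqn_leq le_ni andbT -ltnS ltn_ord.
Qed.

Let measurable_extend t : measurable_fun setT (@extend t).
Proof.
apply: measurable_fun_pair; apply: measurable_rcons => //.
- apply: (measurableT_comp measurable_fst).
  exact: (measurableT_comp measurable_fst measurable_fst).
- apply: (measurableT_comp measurable_snd).
  exact: (measurableT_comp measurable_fst measurable_fst).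
- exact: (measurableT_comp measurable_snd measurable_fst).
Qed.

HB.instance Definition _ :=
  isMeasurableFun.Build _ _ _ _ initial_history measurable_initial_history.
HB.instance Definition _ t :=
  isMeasurableFun.Build _ _ _ _ (@last_state t) (@measurable_last_state t).
HB.instance Definition _ t :=
  isMeasurableFun.Build _ _ _ _ (@last_pair t) (@measurable_last_pair t).
HB.instance Definition _ t :=
  isMeasurableFun.Build _ _ _ _ (@extend t) (@measurable_extend t).

(* P(dx_{0:t}, da_{0:t-1}) pi(da_t | x_{0:t}, a_{0:t-1}) p(dx_{t+1} | x_t, a_t) *)
Definition step t (P : probability (history S A t) R)
    (pi : R.-pker (history S A t) ~> A) (p : R.-pker (S * A) ~> S) :
    probability (history S A t.+1) R :=
  distribution (semidirect (semidirect P pi) (kprecomp p (@last_pair t)))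
    (@extend t).

Variable T : nat.

Record controlled_system := ControlledSystem {
  initial_law : probability S R ;
  transition : 'I_T -> R.-pker (S * A) ~> S }.

Definition history_policy := forall t : 'I_T, R.-pker (history S A t) ~> A.

Definition markov_policy := 'I_T -> R.-pker S ~> A.

(* pi_t (da | x_{0:t}, a_{0:t-1}) = pi_t (da | x_t) *)
Definition history_of_markov (pi : markov_policy) : history_policy :=
  fun t => kprecomp (pi t) (@last_state t).

(* The law of (x_{0:t}, a_{0:t-1}) under pi; trajectory_law is the case
   t = T. *)
Fixpoint history_law (sys : controlled_system) (pi : history_policy) (t : nat) :
    (t <= T)%N -> probability (history S A t) R :=
  match t return (t <= T)%N -> probability (history S A t) R with
  | 0 => fun=> distribution (initial_law sys) initial_history
  | t'.+1 => fun lt_t'T : (t' < T)%N =>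
      step (history_law sys pi (ltnW lt_t'T))
        (pi (Ordinal lt_t'T)) (transition sys (Ordinal lt_t'T))
  end.

Definition trajectory_law (sys : controlled_system) (pi : history_policy) :
  probability (history S A T) R := history_law sys pi (leqnn T).

(* x_t for t <= T, and a_t for t < T *)
Definition state_at (t : 'I_T.+1) (h : history S A T) : S := tnth h.1 t.
Definition input_at (t : 'I_T) (h : history S A T) : A := tnth h.2 t.

Section objective.
Variables (g : 'I_T -> S * A -> R) (gT : S -> R).

Definition stage_term (t : 'I_T) (h : history S A T) : R :=
  g t (state_at (widen_ord (leqnSn T) t) h, input_at t h).

Definition final_term (h : history S A T) : R := gT (state_at ord_max h).

Definition objective (P : probability (history S A T) R) : \bar R :=
  'E_P[fun h => \sum_(t < T) stage_term t h + final_term h].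

(* The sum of the expectations of the positive parts of the terms, or that of
   the negative parts, is finite. *)
Definition objective_well_defined (P : probability (history S A T) R) : Prop :=
  (\sum_(t < T) 'E_P[(stage_term t)^\+] + 'E_P[final_term^\+] < +oo)%E \/
  (\sum_(t < T) 'E_P[(stage_term t)^\-] + 'E_P[final_term^\-] < +oo)%E.

End objective.

End controlled_system.

Arguments controlled_system {R dS dA} S A T.
Arguments history_policy R {dS dA} S A T.
Arguments markov_policy R {dS dA} S A T.

Section alarm_counter.
Context {R : realType} {dX dA dW : measure_display}.
Context {X : measurableType dX} {A : measurableType dA}
  {W : measurableType dW}.
Variables (Xa : set X) (mXa : measurable Xa) (M : nat).

(* inord 1 is the count 1 as soon as 1 <= M; x \in Xa is decided classically. *)
Definition initial_count (x : X) : 'I_M.+1 :=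
  if x \in Xa then inord 1 else ord0.

Definition next_count (phi : 'I_M.+1) (x : X) : 'I_M.+1 :=
  if phi == ord_max then ord_max
  else if x \in Xa then inord phi.+1 else phi.

(* The proof that Xa is measurable is an argument of the next two maps only so
   that their mfun structures can be found by unification. *)
Definition augmented_initial of measurable Xa :=
  fun x : X => (x, initial_count x).

Definition augmented_step of measurable Xa :=
  fun (f : {mfun (X * A * W)%type >-> X}) (z : X * 'I_M.+1 * A * W) =>
  let x' := f (z.1.1.1, z.1.2, z.2) in (x', next_count z.1.1.2 x').

Let measurable_alarm : measurable_fun setT (fun x : X => x \in Xa).
Proof.
apply: (measurable_fun_bool true); rewrite setTI.
by rewrite (_ : _ @^-1` _ = Xa)//; apply/seteqP; split => x /=; [exact: set_mem|exact: mem_set].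
Qed.

Let measurable_augmented_initial :
  measurable_fun setT (augmented_initial mXa).
Proof.
apply: measurable_fun_pair => //; exact: measurable_fun_ifT.
Qed.

Let measurable_next_count d (U : measurableType d) (phi : U -> 'I_M.+1)
    (x : U -> X) : measurable_fun setT phi -> measurable_fun setT x ->
  measurable_fun setT (fun u => next_count (phi u) (x u)).
Proof.
move=> mphi mx; apply: measurable_fun_ifT => //.
  have m1 : measurable_fun setT (fun p : 'I_M.+1 => p == ord_max) by [].
  exact: (measurableT_comp m1).
apply: measurable_fun_ifT => //.
  exact: (measurableT_comp measurable_alarm).
have m2 : measurable_fun setT (fun p : 'I_M.+1 => inord p.+1 : 'I_M.+1) by [].
exact: (measurableT_comp m2).
Qed.

Let measurable_augmented_step f :
  measurable_fun setT (augmented_step mXa f).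
Proof.
pose D := (X * 'I_M.+1 * A * W)%type.
have m1 : measurable_fun setT (fun z : D => z.1.1).
  exact: (measurableT_comp measurable_fst measurable_fst).
have ma : measurable_fun setT (fun z : D => z.1.2).
  exact: (measurableT_comp measurable_snd measurable_fst).
have mx' : measurable_fun setT (fun z : D => f (z.1.1.1, z.1.2, z.2)).
  apply: (measurableT_comp (measurable_funPT f)).
  apply: measurable_fun_pair; last exact: measurable_snd.
  apply: measurable_fun_pair => //.
  exact: (measurableT_comp measurable_fst m1).
apply: measurable_fun_pair => //; apply: measurable_next_count => //.
exact: (measurableT_comp measurable_snd m1).
Qed.

HB.instance Definition _ :=
  isMeasurableFun.Build _ _ _ _ (augmented_initial mXa)
    measurable_augmented_initial.
HB.instance Definition _ f :=
  isMeasurableFun.Build _ _ _ _ (augmented_step mXa f)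
    (measurable_augmented_step f).

Variables (f : {mfun (X * A * W)%type >-> X}) (T : nat).
Variables (p0 : probability X R) (noise : 'I_T -> probability W R).

(* noise t is the law of w_t. Independence of the noises (and of x_0) is what
   makes w_t have law noise t given the history up to time t, so that x_{t+1}
   has law noise_kernel (noise t) f (x_t, a_t). *)
Definition original_system : controlled_system X A T :=
  {| initial_law := p0 ;
     transition := fun t => noise_kernel (noise t) f |}.

Definition augmented_system : controlled_system (X * 'I_M.+1)%type A T :=
  {| initial_law := distribution p0 (augmented_initial mXa) ;
     transition := fun t => noise_kernel (noise t) (augmented_step mXa f) |}.

Definition alarm_number (h : history X A T) : nat :=
  #|[pred t : 'I_T.+1 | state_at t h \in Xa]|.

Definition final_count (h : history (X * 'I_M.+1)%type A T) : nat :=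
  (state_at ord_max h).2.

End alarm_counter.

(* Main.v *)
Require Import Defs.
From HB Require Import structures.
From mathcomp Require Import all_boot all_order all_algebra.
From mathcomp Require Import all_classical all_reals all_analysis measurable_realfun.
From mathcomp Require Import ring lra.
Import Order.TTheory GRing.Theory Num.Theory.
Import numFieldNormedType.Exports.
Local Open Scope classical_set_scope.
Local Open Scope ring_scope.
(* The reward and the constraints depend on a policy only through the joint laws
   of (x_t, phi_t, a_t), where phi_t, the number of alarms up to time t capped at
   M, is a function of x_{0:t}. A history-dependent policy and a Markov policy of
   the augmented system yield the same laws, by induction on t, as soon as the
   Markov policy at time t is the conditional law of a_t given (x_t, phi_t) under
   the history-dependent one. Every Markov policy arises so from the policy that
   computes phi_t from the history, and conversely every history-dependent policy
   has such a conditional law because A is a Borel subset of R^m.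

   Conditional laws are obtained as y = G(z, u) with u an independent noise. On
   the extended real line G is the conditional quantile function built from
   Radon-Nikodym densities; products and measurable retracts then give R, R^m and
   Borel subsets of R^m. *)


Set Implicit Arguments.
Unset Strict Implicit.

Definition mfun_of d d' (X : measurableType d) (Y : measurableType d')
    (f : X -> Y) (mf : measurable_fun setT f) : {mfun X >-> Y} :=
  HB.pack f (isMeasurableFun.Build _ _ _ _ f mf).

(** * Conditional laws *)

Section conditional_density.
Context {R : realType} {dZ : measure_display} {Z : measurableType dZ}.
Local Open Scope ereal_scope.

(** On the set where [g < f], the hypothesis and the pointwise bound force equal integrals over
    every measurable subset. Hence [f = g] almost everywhere there, and the set is null. *)
Lemma ae_le_integral_le (nu : {measure set Z -> \bar R}) (f g : Z -> \bar R) :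
  nu.-integrable setT f -> nu.-integrable setT g ->
  (forall C, measurable C -> \int[nu]_(x in C) f x <= \int[nu]_(x in C) g x) ->
  \forall x \ae nu, f x <= g x.
Proof.
move=> fi gi fg.
have mf := measurable_int _ fi; have mg := measurable_int _ gi.
have mE : measurable [set x | g x < f x].
  by rewrite -[X in measurable X]setTI; exact: measurable_lte.
have : ae_eq nu [set x | g x < f x] f g.
  apply: integral_ae_eq => //.
  - exact: integrableS fi.
  - exact: measurable_funS mg.
  - move=> C CE mC; apply/eqP; rewrite eq_le fg//=.
    apply: le_integral => //; [exact: integrableS gi|exact: integrableS fi|].
    by move=> x /[!inE] /CE /ltW.
apply: filterS => x /= fgx; rewrite leNgt; apply/negP => gfx.
by move: (gfx); rewrite (fgx gfx) ltxx.
Qed.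

(** [g] is a version of the conditional probability of [D] given [z]: the measure taking [C] to the
    [mu]-mass of the rectangle over [C] and [D] is dominated by [nu], and has a Radon-Nikodym
    density. *)
Lemma conditional_density d (Y : measurableType d)
    (nu : probability Z R) (mu : probability (Z * Y)%type R)
    (munu : forall C, measurable C -> mu (C `*` setT) = nu C) (D : set Y)
    (mD : measurable D) :
  {g : Z -> \bar R | [/\ measurable_fun setT g, (forall z, 0 <= g z <= 1) &
    forall C, measurable C -> mu (C `*` D) = \int[nu]_(z in C) g z]}.
Proof.
apply: cid.
have mTD : measurable ([set: Z] `*` D) by exact: measurableX.
have fD : mu ([set: Z] `*` D) < +oo.
  by rewrite (le_lt_trans (probability_le1 _ _)) ?ltry.
pose r := mfrestr mTD fD.
pose m0 : {measure set Z -> \bar R} := pushforward r fst.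
pose m := m0 measurable_fst.
have mE C : m C = mu (C `*` D).
  rewrite /m /m0 /= /pushforward /r /= /mfrestr /mrestr; congr (mu _).
  by apply/seteqP; split => -[z y] /=; [move=> [? []]|move=> []].
have mle C : measurable C -> m C <= nu C.
  move=> mC; rewrite mE -munu//; apply: le_measure; rewrite ?inE.
  - exact: measurableX.
  - exact: measurableX.
  - by move=> [z y] [].
have mfin : fin_num_fun m.
  move=> C mC; rewrite ge0_fin_numE ?measure_ge0//.
  by rewrite (le_lt_trans (mle _ mC))// (le_lt_trans (probability_le1 _ _)) ?ltry.
pose m' : {finite_measure set Z -> \bar R} :=
  HB.pack (Measure.sort m) (Measure_isFinite.Build _ _ _ m mfin).
have dom : m' `<< nu.
  apply/null_content_dominatesP => C mC nuC.
  by apply/eqP; rewrite eq_le measure_ge0 andbT -nuC; exact: mle.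
pose g0 := Radon_Nikodym_SigmaFinite.f m' nu.
have ig0 : nu.-integrable setT g0 by exact: Radon_Nikodym_SigmaFinite.f_integrable.
have mg0 := measurable_int _ ig0.
have g0E C : measurable C -> m' C = \int[nu]_(x in C) g0 x.
  by move=> mC; exact: Radon_Nikodym_SigmaFinite.f_integral.
have g0ge z : 0 <= g0 z by exact: Radon_Nikodym_SigmaFinite.f_ge0.
have g0le : \forall z \ae nu, g0 z <= 1.
  apply: (@ae_le_integral_le _ _ (cst 1)) => //.
    exact: finite_measure_integrable_cst.
  by move=> C mC; rewrite -g0E// integral_cst// mul1e; exact: mle.
(* Truncation at 1 changes the density on a [nu]-null set only and gives the bounds at every [z]. *)
exists (fun z => mine (g0 z) 1); split.
- by apply: measurable_mine.
- by move=> z; rewrite le_min g0ge lee01 ge_min lexx orbT.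
- move=> C mC; rewrite -mE; have /= -> := g0E _ mC.
  apply: ae_eq_integral => //.
  + exact: measurable_funS mg0.
  + by apply: measurable_mine => //; exact: measurable_funS mg0.
  + by apply: filterS g0le => z /= z1 _; rewrite min_l.
Qed.

End conditional_density.

(** * Realization of conditional laws by independent noise *)

Section randomization.
Context {R : realType}.
Local Open Scope ereal_scope.

(* mu(dz, dy) is the law of (z, G (z, o)) when (z, o) has law nu x la. *)
Definition randomizes {dZ dY dO} {Z : measurableType dZ} {Y : measurableType dY}
    {O : measurableType dO} (nu : probability Z R) (la : probability O R)
    (G : Z * O -> Y) (mu : probability (Z * Y)%type R) :=
  forall U, measurable U -> mu U = \int[nu]_z la [set o | U (z, G (z, o))].

(** The noise space may depend on [mu], which lets a product of spaces use a product of noises. *)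
Definition randomizable d (Y : measurableType d) :=
  forall dZ (Z : measurableType dZ) (nu : probability Z R)
    (mu : probability (Z * Y)%type R),
  (forall C, measurable C -> mu (C `*` setT) = nu C) ->
  exists (dO : measure_display) (O : measurableType dO) (la : probability O R)
    (G : Z * O -> Y), measurable_fun setT G /\ randomizes nu la G mu.

Lemma measurable_graph_section {dZ dY dO} {Z : measurableType dZ}
    {Y : measurableType dY} {O : measurableType dO} (la : probability O R)
    (G : Z * O -> Y) (U : set (Z * Y)) :
  measurable_fun setT G -> measurable U ->
  measurable_fun setT (fun z => la [set o | U (z, G (z, o))]).
Proof.
move=> mG mU.
have mp : measurable_fun setT (fun zo : Z * O => (zo.1, G zo)).
  exact: measurable_fun_pair.
have mV : measurable ((fun zo : Z * O => (zo.1, G zo)) @^-1` U).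
  by rewrite -[X in measurable X]setTI; exact: mp.
have := measurable_fun_xsection la mV.
apply: eq_measurable_fun => z _ /=; rewrite xsectionE.
by congr (la _).
Qed.

(** Drawing [G (z, o)] with fresh noise is sampling from the kernel that sends [z] to the law of
    [G (z, o)]. In particular the integral is a measure in [U]. *)
Lemma randomizesE {dZ dY dO} {Z : measurableType dZ} {Y : measurableType dY}
    {O : measurableType dO} (nu : probability Z R) (la : probability O R)
    (G : Z * O -> Y) (mG : measurable_fun setT G) U :
  \int[nu]_z la [set o | U (z, G (z, o))] =
  semidirect nu (noise_kernel la (mfun_of mG)) U.
Proof.
apply: eq_integral => z _.
rewrite /noise_kernel /distribution /pushforward /=; congr (la _).
by apply/seteqP; split => o /=; rewrite /xsection /= inE.
Qed.

Lemma uniform_le (c : \bar R) : 0 <= c <= 1 ->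
  uniform_prob (@ltr01 R) [set u | u%:E <= c] = c.
Proof.
case: c => [c||]; [rewrite !lee_fin => /andP[c0 c1]|by case/andP..].
rewrite /uniform_prob integral_uniform_pdf.
rewrite (_ : _ `&` _ = `[0%R, c]%classic); last first.
  apply/seteqP; split => u /=; rewrite !in_itv/= lee_fin.
    by move=> [-> /andP[-> _]].
  by move=> /andP[-> uc]; rewrite uc (le_trans uc).
rewrite (eq_integral (cst 1)); last first.
  move=> u /[!inE] /=; rewrite in_itv/= => /andP[u0 uc].
  by rewrite /uniform_pdf u0 (le_trans uc c1) subr0 invr1.
rewrite integral_cst//= mul1e lebesgue_measure_itv/= lte_fin.
have [c_gt0|c_le0] := ltP 0%R c; first by rewrite oppr0 adde0.
by congr (_%:E); apply/eqP; rewrite eq_le c0.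
Qed.

(** A generating pi-system for uniqueness of measures. Half-lines with real endpoints miss [+oo];
    [setT] supplies the full rectangles against which complements in the second factor are taken. *)
Lemma measurable_prod_ereal d (Z : measurableType d) :
  @measurable _ (Z * \bar R)%type =
  <<s [set A `*` B | A in measurable & B in
    [set B : set (\bar R) | B = setT \/ exists r : R, B = [set y | y < r%:E]]] >>.
Proof.
set G := (X in <<s X >>).
have GT A : measurable A -> <<s G >> (A `*` setT).
  by move=> mA; apply: sub_sigma_algebra; exists A => //; exists setT => //; left.
apply/seteqP; split; last first.
  apply: smallest_sub; first exact: sigma_algebra_measurable.
  move=> _ [A mA [B [->|[r ->]] <-]]; apply: measurableX => //.
  by rewrite -[X in measurable X]setTI; exact: measurable_lte.
rewrite measurable_prod_measurableType.
apply: smallest_sub; first exact: smallest_sigma_algebra.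
move=> _ [A mA [B mB <-]].
have : <<s @ErealGenInftyO.G R >> B.
  by move: mB; rewrite /measurable /= ErealGenInftyO.measurableE.
suff : <<s @ErealGenInftyO.G R >> `<=` [set B | <<s G >> (A `*` B)] by exact.
have [G0 GC GU] := @smallest_sigma_algebra _ setT G.
apply: smallest_sub; first split => /=.
- by rewrite setX0.
- move=> C GAC; rewrite setTD.
  rewrite (_ : _ `*` _ = (A `*` setT) `\` (A `*` C)).
    by apply: (@measurableD _ (g_sigma_algebraType G)) => //; exact: GT.
  by apply/seteqP; split => -[z y] /=; tauto.
- by move=> F GF; rewrite setX_bigcupr; exact: GU.
- move=> _ [r ->]; apply: sub_sigma_algebra; exists A => //.
  exists [set y | y < r%:E]; first by right; exists r.
  by rewrite set_itvE.
Qed.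


(* With values in \bar R the infimum of an empty or unbounded set of quantiles
   needs no special treatment, nor do the limits of the distribution functions at
   infinity. *)
Lemma randomizable_ereal : randomizable (\bar R).
Proof.
move=> dZ Z nu mu munu.
pose D (r : R) : set (\bar R) := [set y | y < r%:E].
have mD r : measurable (D r).
  by rewrite -[X in measurable X]setTI; exact: measurable_lte.
(* The densities for different [r] are chosen separately, so monotonicity in [r] is only available
   almost everywhere for each pair. *)
pose g r := sval (conditional_density munu (mD r)).
have mg r : measurable_fun setT (g r).
  by rewrite /g; case: conditional_density => ? [].
have g01 r z : 0 <= g r z <= 1 by rewrite /g; case: conditional_density => ? [].
have gE r C : measurable C -> mu (C `*` D r) = \int[nu]_(z in C) g r z.
  by rewrite /g; case: conditional_density => ? [_ _ +] /=; apply.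
have g_le (q r : R) : (q < r)%R -> \forall z \ae nu, g q z <= g r z.
  move=> qr.
  have ig s : nu.-integrable setT (g s).
    apply: (le_integrable measurableT (mg s) (g := cst 1)).
      by move=> z _ /=; have /andP[g0 g1] := g01 s z; rewrite gee0_abs// normr1.
    exact: finite_measure_integrable_cst.
  apply: ae_le_integral_le => // C mC; rewrite -!gE//.
  apply: le_measure; rewrite ?inE; [exact: measurableX|exact: measurableX|].
  move=> [z y] [? ?]; split => //.
  by apply: lt_trans (_ : _ < q%:E) _ => //; rewrite lte_fin.
pose la : probability (measurableTypeR R) R := uniform_prob (@ltr01 R).
(* The conditional quantile: the infimum of the rational levels at which the conditional
   distribution function reaches [u]. *)
pose G (zu : Z * measurableTypeR R) : \bar R :=
  ereal_inf [set (ratr q)%:E | q in [set q : rat | (zu.2)%:E <= g (ratr q) zu.1]].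
(* Rational levels turn this event into a countable union, whence the measurability of [G]. *)
have GD z u r : D r (G (z, u)) <->
    exists q : rat, (ratr q < r)%R /\ u%:E <= g (ratr q) z.
  split.
    move=> /ereal_inf_lt[_ [q /= uq <-]]; rewrite lte_fin => qr.
    by exists q.
  move=> [q [qr uq]]; rewrite /D /=.
  apply: (@le_lt_trans _ _ (ratr q)%:E); last by rewrite lte_fin.
  by apply: ereal_inf_lbound; exists q.
have mG : measurable_fun setT G.
  apply: (measurability _ (ErealGenInftyO.measurableE R)) => _ [_ [r ->] <-].
  rewrite setTI (_ : _ @^-1` _ = \bigcup_(q in [set q : rat | (ratr q < r)%R])
      [set zu | (zu.2)%:E <= g (ratr q) zu.1]).
    rewrite bigcup_mkcond; apply: bigcupT_measurable_rat => q.
    case: ifPn => // _; rewrite -[X in measurable X]setTI.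
    apply: measurable_lee => //.
      by apply/measurable_EFinP; exact: measurable_snd.
    exact: (measurableT_comp (mg _) measurable_fst).
  rewrite (_ : [set` Interval -oo%O (BLeft r%:E)] = D r); last first.
    by apply/seteqP; split => y /=; rewrite in_itv.
  apply/seteqP; split => -[z u] /=.
    by move=> /GD[q [qr uq]]; exists q.
  by move=> [q /= qr uq]; apply/GD; exists q.
have hm r : measurable_fun setT (fun z => la [set u | D r (G (z, u))]).
  have := measurable_graph_section la mG (measurableX measurableT (mD r)).
  apply: eq_measurable_fun => z _; congr (la _).
  by apply/seteqP; split => u /=; [move=> [_]|split].
have lag z r : la [set u | u%:E <= g r z] = g r z by apply: uniform_le; exact: g01.
have mlag z r : measurable [set u : measurableTypeR R | u%:E <= g r z].
  by rewrite -[X in measurable X]setTI; apply: measurable_lee.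
have mGD z r : measurable [set u : measurableTypeR R | D r (G (z, u))].
  rewrite -[X in measurable X]setTI.
  exact: (measurableT_comp mG (pair1_measurable z)).
(* The two laws agree on half-lines. The upper bound uses almost sure monotonicity along the
   rationals below [r], the lower bound continuity of [mu] from below. *)
have key r C : measurable C ->
    \int[nu]_(z in C) la [set u | D r (G (z, u))] = mu (C `*` D r).
  move=> mC; apply/eqP; rewrite eq_le; apply/andP; split.
    rewrite gE//; apply: ae_ge0_le_integral => //.
    - exact: measurable_funS (hm r).
    - by move=> z _; have /andP[] := g01 r z.
    - exact: measurable_funS (mg r).
    (* Enumerating the rationals by [unpickle] makes countably many almost sure inequalities hold at
       once. *)
    have : \forall z \ae nu, forall n, (if unpickle n is Some q then
        (ratr q < r)%R -> g (ratr q) z <= g r z else True).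
      apply: ae_foralln => n; case: unpickle => [q|]; last exact: aeW.
      have [qr|rq] := ltP (ratr q) r; last exact: aeW.
      by apply: filterS (g_le _ _ qr).
    apply: filterS => z gz _; rewrite -(lag z r); apply: le_measure; rewrite ?inE//.
    move=> u /GD[q [qr uq]] /=; apply: (le_trans uq).
    by have := gz (pickle q); rewrite pickleK; exact.
  (* The half-lines at [r - 1/(n+1)] exhaust [D r]. For a rational [q] strictly between that
     endpoint and [r], the mass of [F n] is at most the integral of [g (ratr q)], itself at most the
     integral for [G]. *)
  pose F n := C `*` D (r - n.+1%:R^-1)%R.
  have mF n : measurable (F n) by exact: measurableX.
  have -> : C `*` D r = \bigcup_n F n.
    rewrite -setX_bigcupr; congr (_ `*` _); apply/seteqP; split => y /=.
      case: y => [y||]; rewrite /D /=.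
      + rewrite lte_fin => yr.
        have [n nyr] := ltr_add_invr yr.
        by exists n => //=; rewrite /D /= lte_fin ltrBrDr.
      + by [].
      + by move=> _; exists 0%N => //=; rewrite /D /= ltNyr.
    move=> [n _]; rewrite /D /= => /lt_le_trans; apply.
    by rewrite lee_fin gerBl invr_ge0.
  have ndF : nondecreasing_seq F.
    move=> a b ab; apply/subsetPset => -[z y] [Cz]; rewrite /D /= => ya.
    split => //=; rewrite /D /=; apply: lt_le_trans ya _.
    by rewrite lee_fin lerB// lef_pV2 ?posrE// ler_nat.
  have cvF := @nondecreasing_cvg_mu _ _ _ mu F mF (bigcupT_measurable _ mF) ndF.
  have /cvg_lim <- // := cvF.
  apply: lime_le; first by apply/cvg_ex; eexists; exact: cvF.
  apply: nearW => n /=.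
  have [q /andP[nq qr]] : exists q : rat, (r - n.+1%:R^-1 < ratr q < r)%R.
    have /rat_in_itvoo[q] : (r - n.+1%:R^-1 < r)%R by rewrite gtrBl invr_gt0.
    by rewrite in_itv/= => ?; exists q.
  apply: (@le_trans _ _ (mu (C `*` D (ratr q)))).
    apply: le_measure; rewrite ?inE; [exact: mF|exact: measurableX|].
    move=> [z y] [Cz]; rewrite /D /= => ya; split => //=.
    by apply: lt_trans ya _; rewrite lte_fin.
  rewrite gE//; apply: ge0_le_integral => //.
  - by move=> z _; have /andP[] := g01 (ratr q) z.
  - exact: measurable_funS (mg _).
  - exact: measurable_funS (hm r).
  - move=> z _; rewrite -(lag z (ratr q)); apply: le_measure; rewrite ?inE//.
    by move=> u uq; apply/GD; exists q.
exists _, (measurableTypeR R), la, G; split => // U mU.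
rewrite (randomizesE _ _ mG).
(* Both sides are finite measures in [U], so agreement on the pi-system suffices; the marginal
   condition settles [setT] and [key] the half-lines. *)
apply: (measure_unique _ (fun=> setT) (measurable_prod_ereal Z)) => //.
- move=> _ _ [A mA [B hB <-]] [A' mA' [B' hB' <-]]; rewrite -setXI.
  exists (A `&` A'); first exact: measurableI.
  exists (B `&` B') => //.
  case: hB hB' => [->|[r ->]] [->|[r' ->]]; rewrite ?setTI ?setIT.
  + by left.
  + by right; exists r'.
  + by right; exists r.
  + right; exists (Num.min r r'); apply/seteqP; split => y /=;
    by rewrite EFin_min lt_min => /andP.
- by move=> _; exists setT => //; exists setT; [left|rewrite setXTT].
- by rewrite bigcup_const//; exists 0%N.
- move=> _ [C mC [B hB <-]]; have /= <- := randomizesE nu la mG.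
  transitivity (\int[nu]_(z in C) la [set u | B (G (z, u))]); last first.
    rewrite [LHS]integral_mkcond; apply: eq_integral => z _.
    rewrite patchE; case: ifPn => [/set_mem Cz|/negP Cz].
      by congr (la _); apply/seteqP; split => u //= [].
    rewrite (_ : [set _ | _] = set0) ?measure0//.
    by apply/seteqP; split => u //= [/mem_set].
  case: hB => [->|[r ->]]; last by rewrite key.
  rewrite munu// (eq_integral (cst 1)) ?integral_cst ?mul1e// => z _.
  by have := probability_setT la; congr (_ = _); congr (la _); apply/seteqP.
- by move=> _; rewrite (le_lt_trans (probability_le1 _ _)) ?ltry.
Qed.

(** * Retracts, products and Borel subsets of Euclidean space *)

Lemma randomizable_retract d d' (Y : measurableType d) (Y' : measurableType d')
    (i : Y -> Y') (r : Y' -> Y) :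
  measurable_fun setT i -> measurable_fun setT r -> cancel i r ->
  randomizable Y' -> randomizable Y.
Proof.
move=> mi mr ir rY' dZ Z nu mu munu.
have mii : measurable_fun setT (fun zy : Z * Y => (zy.1, i zy.2)).
  by apply: measurable_fun_pair => //; exact: measurableT_comp.
have mrr : measurable_fun setT (fun zy : Z * Y' => (zy.1, r zy.2)).
  by apply: measurable_fun_pair => //; exact: measurableT_comp.
(* Randomize the law of [(z, i y)] and return through [r]; the identity [r (i y) = y] restores the
   original law. *)
have [C mC|dO [Om [la [G [mG muG]]]]] :=
  rY' _ Z nu (distribution mu (mfun_of mii)).
  by rewrite -munu// /distribution /pushforward /=; congr (mu _).
exists dO, Om, la, (r \o G); split; first exact: measurableT_comp.
move=> U mU.
have mU' : measurable ((fun zy : Z * Y' => (zy.1, r zy.2)) @^-1` U).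
  by rewrite -[X in measurable X]setTI; exact: mrr.
rewrite -(muG _ mU') /distribution /pushforward /=; congr (mu _).
by apply/seteqP; split => -[z y] /=; rewrite ir.
Qed.

(** Chain rule: draw [y1] given [z], then [y2] given [(z, y1)], with independent noises; Fubini's
    theorem reassembles the joint law. *)
Lemma randomizable_prod d1 d2 (Y1 : measurableType d1) (Y2 : measurableType d2) :
  randomizable Y1 -> randomizable Y2 -> randomizable (Y1 * Y2)%type.
Proof.
move=> r1 r2 dZ Z nu mu munu.
have m1 : measurable_fun setT (fun zy : Z * (Y1 * Y2) => (zy.1, zy.2.1)).
  by apply: measurable_fun_pair => //; exact: measurableT_comp.
have m2 : measurable_fun setT (fun zy : Z * (Y1 * Y2) => ((zy.1, zy.2.1), zy.2.2)).
  by apply: measurable_fun_pair => //; exact: measurableT_comp.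
pose mu1 := distribution mu (mfun_of m1).
pose mu2 := distribution mu (mfun_of m2).
have [C mC|dO1 [Om1 [la1 [G1 [mG1 mu1G]]]]] := r1 _ Z nu mu1.
  by rewrite -munu// /distribution /pushforward /=; congr (mu _).
have [C mC|dO2 [Om2 [la2 [G2 [mG2 mu2G]]]]] := r2 _ _ mu1 mu2.
  rewrite /mu1 /mu2 /distribution /pushforward /=; congr (mu _).
  by apply/seteqP; split => -[z y] //= [].
pose H (zo : Z * Om1) := (zo.1, G1 zo).
have mH : measurable_fun setT H by exact: measurable_fun_pair.
pose G (zo : Z * (Om1 * Om2)) : Y1 * Y2 :=
  let y1 := G1 (zo.1, zo.2.1) in (y1, G2 ((zo.1, y1), zo.2.2)).
have mzo : measurable_fun setT (fun zo : Z * (Om1 * Om2) => (zo.1, zo.2.1)).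
  by apply: measurable_fun_pair => //; exact: measurableT_comp.
have mG : measurable_fun setT G.
  apply: measurable_fun_pair; first exact: measurableT_comp.
  apply: (measurableT_comp mG2); apply: measurable_fun_pair.
    exact: (measurableT_comp mH mzo).
  exact: measurableT_comp.
exists _, (Om1 * Om2)%type, (la1 \x la2), G; split => // U mU.
pose V := [set wy : Z * Y1 * Y2 | U (wy.1.1, (wy.1.2, wy.2))].
have mV : measurable V.
  rewrite -[X in measurable X]setTI.
  have mUV : measurable_fun setT (fun wy : Z * Y1 * Y2 => (wy.1.1, (wy.1.2, wy.2))).
    apply: measurable_fun_pair; first exact: measurableT_comp.
    by apply: measurable_fun_pair => //; exact: measurableT_comp.
  exact: mUV.
pose h w := la2 [set o | V (w, G2 (w, o))].
have mh : measurable_fun setT h by exact: measurable_graph_section.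
have h0 w : 0 <= h w by exact: measure_ge0.
transitivity (\int[mu1]_w h w).
  rewrite -[RHS]mu2G// /mu2 /distribution /pushforward /=; congr (mu _).
  by apply/seteqP; split => -[z [y1 y2]].
(* The law [mu1] of [(z, y1)] is the image under [H] of the product of [nu] and the first noise. *)
transitivity (\int[distribution (nu \x la1) (mfun_of mH)]_w h w).
  apply: eq_measure_integral => B mB _ /=.
  rewrite mu1G// /distribution /pushforward /product_measure1 /=.
  apply: eq_integral => z _; congr (la1 _).
  by apply/seteqP; split => o /=; rewrite xsectionE.
rewrite ge0_integral_distribution// fubini_tonelli1//=; last first.
  exact: (measurableT_comp mh mH).
apply: eq_integral => z _; rewrite /fubini_F /product_measure1 /=.
apply: eq_integral => o1 _; rewrite /h; congr (la2 _).
by apply/seteqP; split => o2 /=; rewrite xsectionE.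
Qed.

Lemma randomizable_real : randomizable R.
Proof.
apply: (@randomizable_retract _ _ _ _ (@EFin R) fine _ _ _ randomizable_ereal) => //.
Qed.

(** A nonempty tuple splits into head and tail; the empty tuples form a single point, a retract of
    the extended line. *)
Lemma randomizable_tuple n : randomizable (n.-tuple R).
Proof.
elim: n => [|n IHn].
  apply: (@randomizable_retract _ _ _ _ (fun=> 0) (fun=> [tuple]) _ _ _
    randomizable_ereal) => //.
  by move=> t; rewrite [t]tuple0.
apply: (@randomizable_retract _ _ _ _
  (fun t : n.+1.-tuple _ => (thead t, [tuple of behead t]))
  (fun xt => [tuple of xt.1 :: xt.2]) _ _ _
  (randomizable_prod randomizable_real IHn)).
- apply: measurable_fun_pair; first exact: measurable_tnth.
  exact: measurable_behead.
- exact: measurable_cons.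
- by move=> t; rewrite [RHS]tuple_eta.
Qed.

(** [B] is a retract of Euclidean space: the retraction sends every outside point to
    [borel_point B], and it is measurable because [B] is Borel. *)
Lemma randomizable_borel n (B : borelSet R n) : randomizable B.
Proof.
pose r (t : n.-tuple R) : B :=
  if pselect (bset B t) is left Bt then SigSub (mem_set Bt) else borel_point B.
apply: (@randomizable_retract _ _ B _ (@borel_val R n B) r _ _ _
  (@randomizable_tuple n)).
- by move=> _ U mU; rewrite setTI; exists U => //; rewrite setTI.
- move=> _ U [V mV <-]; rewrite setTI setTI.
  have -> : r @^-1` (@borel_val R n B @^-1` V) =
      (bset B `&` V) `|` (~` bset B `&` [set t | V (borel_val (borel_point B))]).
    apply/seteqP; split => t /=; rewrite /r; case: pselect => Bt /=; tauto.
  have [Vb|Vb] := pselect (V (borel_val (borel_point B))).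
    rewrite (_ : [set t | _] = setT); last by apply/seteqP; split.
    apply: measurableU; first by apply: measurableI => //; exact: bset_measurable.
    by rewrite setIT; apply: measurableC; exact: bset_measurable.
  rewrite (_ : [set t | _] = set0); last by apply/seteqP; split.
  rewrite setI0 setU0; apply: measurableI => //; exact: bset_measurable.
- move=> x; rewrite /r; case: pselect => Bt; first by apply/val_inj.
  by case: Bt; exact: set_mem (valP x).
Qed.

(** The conditional law at [z] is the law of [G (z, o)] over the noise [o]. *)
Lemma randomizable_disintegration d dZ (Y : measurableType d)
    (Z : measurableType dZ)
    (nu : probability Z R) (mu : probability (Z * Y)%type R) :
  randomizable Y ->
  (forall C, measurable C -> mu (C `*` setT) = nu C) ->
  exists k : R.-pker Z ~> Y, forall U, measurable U -> mu U = semidirect nu k U.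
Proof.
move=> rY munu; have [dO [Om [la [G [mG muG]]]]] := rY _ _ nu mu munu.
by exists (noise_kernel la (mfun_of mG)) => U mU; rewrite muG//; exact: randomizesE.
Qed.

End randomization.

(** * Laws of trajectories *)

Section laws.
Context {R : realType}.
Local Open Scope ereal_scope.

Lemma semidirect_fst {dX dY} {X : measurableType dX} {Y : measurableType dY}
    (mu : probability X R) (k : R.-pker X ~> Y) B : measurable B ->
  semidirect mu k (B `*` setT) = mu B.
Proof.
move=> mB; rewrite /semidirect -[RHS]mul1e -integral_cst// integral_mkcond.
apply: eq_integral => x _; rewrite patchE; case: ifPn => xB.
  by rewrite (in_xsectionX _ xB) prob_kernel.
by rewrite (notin_xsectionX _ xB) measure0.
Qed.

(** The integral of a nonnegative function of an observable sees only the law of the observable;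
    this is how two different trajectory spaces are compared. *)
Lemma eq_ge0_integral_law {d1 d2 d} {O1 : measurableType d1}
    {O2 : measurableType d2} {Y : measurableType d}
    (P1 : probability O1 R) (P2 : probability O2 R)
    (r1 : O1 -> Y) (r2 : O2 -> Y) (phi : Y -> \bar R) :
  measurable_fun setT r1 -> measurable_fun setT r2 ->
  (forall U, measurable U -> P1 (r1 @^-1` U) = P2 (r2 @^-1` U)) ->
  measurable_fun setT phi -> (forall y, 0 <= phi y) ->
  \int[P1]_x phi (r1 x) = \int[P2]_x phi (r2 x).
Proof.
move=> m1 m2 P12 mphi phi0.
transitivity (\int[distribution P1 (mfun_of m1)]_y phi y).
  by rewrite ge0_integral_distribution.
transitivity (\int[distribution P2 (mfun_of m2)]_y phi y).
  by apply: eq_measure_integral => U mU _; exact: P12.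
by rewrite ge0_integral_distribution.
Qed.

(** * Expectations of quasi-integrable sums *)

Section quasi_integrable.
Context {d} {O : measurableType d} (P : probability O R).

(** [p] and [n] may both be positive at a point. They dominate the positive and negative parts of
    [p - n], and finiteness of one expectation rules out [oo - oo]. *)
Lemma expectationB_ge0 (p n : O -> R) :
  measurable_fun setT p -> measurable_fun setT n ->
  (forall x, 0 <= p x)%R -> (forall x, 0 <= n x)%R ->
  'E_P[p] < +oo \/ 'E_P[n] < +oo ->
  'E_P[fun x => p x - n x]%R = 'E_P[p] - 'E_P[n].
Proof.
move=> mp mn p0 n0; rewrite !expectation.unlock.
pose u x := (p x - n x)%:E.
have mEp : measurable_fun setT (EFin \o p) by exact/measurable_EFinP.
have mEn : measurable_fun setT (EFin \o n) by exact/measurable_EFinP.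
have mu : measurable_fun setT u by apply/measurable_EFinP; exact: measurable_funB.
have mup := measurable_funepos mu; have mun := measurable_funeneg mu.
(* u^+ + n = u^- + p involves no subtraction, so it integrates termwise. *)
have E : \int[P]_x u^\+ x + \int[P]_x (n x)%:E =
    \int[P]_x u^\- x + \int[P]_x (p x)%:E.
  rewrite -!ge0_integralD//; try by move=> x _; rewrite lee_fin.
  apply: eq_integral => x _; rewrite /u funeposE funenegE -EFinN -!EFin_max -!EFinD.
  congr EFin; have [pn|pn] := leP (p x) (n x).
    by rewrite (@max_r _ _ (_ - _)%R) ?subr_le0// max_l ?opprB ?subr_ge0//; ring.
  rewrite (@max_l _ _ (_ - _)%R) ?subr_ge0 ?(ltW pn)//.
  by rewrite max_r ?opprB ?subr_le0 ?(ltW pn)//; ring.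
have up : \int[P]_x u^\+ x <= \int[P]_x (p x)%:E.
  apply: ge0_le_integral => //.
  by move=> x _; rewrite /u funeposE -EFin_max lee_fin ge_max p0 gerBl n0.
have un : \int[P]_x u^\- x <= \int[P]_x (n x)%:E.
  apply: ge0_le_integral => //.
  by move=> x _; rewrite /u funenegE -EFinN -EFin_max lee_fin ge_max n0 opprB gerBl p0.
have up0 : 0 <= \int[P]_x u^\+ x by exact: integral_ge0.
have un0 : 0 <= \int[P]_x u^\- x by exact: integral_ge0.
rewrite [LHS]integralE -/u.
move: E up un up0 un0.
move: (\int[P]_x u^\+ x) (\int[P]_x u^\- x) (\int[P]_x (n x)%:E)
  (\int[P]_x (p x)%:E) => [a||] [b||] [c||] [e||] //=.
- by rewrite -!EFinD => -[/eqP abce] *; congr EFin; lra.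
all: by move=> _ _ _ _ _ [].
Qed.

(** Splits the expected total into expectations of parts of single terms, each of which will depend
    on one stage of the trajectory only. *)
Lemma expectation_quasi_sum T (F : 'I_T -> O -> R) (H : O -> R) :
  (forall t, measurable_fun setT (F t)) -> measurable_fun setT H ->
  \sum_(t < T) 'E_P[(F t)^\+] + 'E_P[H^\+] < +oo \/
  \sum_(t < T) 'E_P[(F t)^\-] + 'E_P[H^\-] < +oo ->
  'E_P[fun h => \sum_(t < T) F t h + H h]%R =
  (\sum_(t < T) 'E_P[(F t)^\+] + 'E_P[H^\+]) -
  (\sum_(t < T) 'E_P[(F t)^\-] + 'E_P[H^\-]).
Proof.
move=> mF mH.
have E (G : 'I_T -> O -> R) (K : O -> R) :
    (forall t, measurable_fun setT (G t)) -> measurable_fun setT K ->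
    (forall t x, 0 <= G t x)%R -> (forall x, 0 <= K x)%R ->
    \sum_(t < T) 'E_P[G t] + 'E_P[K] =
    'E_P[fun h => \sum_(t < T) G t h + K h]%R.
  move=> mG mK G0 K0; rewrite !expectation.unlock.
  under [RHS]eq_integral do rewrite EFinD -sumEFin.
  rewrite ge0_integralD//; last 4 first.
  - by move=> x _; apply: sume_ge0 => t _; rewrite lee_fin.
  - by apply: emeasurable_sum => t; exact/measurable_EFinP.
  - by move=> x _; rewrite lee_fin.
  - exact/measurable_EFinP.
  rewrite ge0_integral_sum//.
  - by move=> t; exact/measurable_EFinP.
  - by move=> t x _; rewrite lee_fin.
have mFp t : measurable_fun setT ((F t)^\+)%R by exact: measurable_funrpos.
have mFn t : measurable_fun setT ((F t)^\-)%R by exact: measurable_funrneg.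
have mHp : measurable_fun setT (H^\+)%R by exact: measurable_funrpos.
have mHn : measurable_fun setT (H^\-)%R by exact: measurable_funrneg.
rewrite !E//; try by move=> *; rewrite ?funrpos_ge0 ?funrneg_ge0.
move=> fin; rewrite -expectationB_ge0//.
- congr expectation; apply/funext => x.
  rewrite opprD addrACA -sumrB; congr (_ + _)%R.
    by apply: eq_bigr => t _; exact: (esym (congr1 (@^~ x) (funrposBneg (F t)))).
  exact: (esym (congr1 (@^~ x) (funrposBneg H))).
- by apply: measurable_funD => //; apply: measurable_sum.
- by apply: measurable_funD => //; apply: measurable_sum.
- by move=> x; apply: addr_ge0; [apply: sumr_ge0 => t _|].
- by move=> x; apply: addr_ge0; [apply: sumr_ge0 => t _|].
Qed.

End quasi_integrable.

(** * Marginals of trajectory laws *)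

Section trajectories.
Context {dS dA} {S : measurableType dS} {A : measurableType dA}.

Lemma last_state_extend t (z : history S A t * A * S) :
  last_state (extend z) = z.2.
Proof.
by rewrite /last_state (tnth_nth z.2) /= nth_rcons size_tuple ltnn eqxx.
Qed.

Lemma step_last t (P : probability (history S A t) R)
    (pi : R.-pker (history S A t) ~> A) (p : R.-pker (S * A)%type ~> S) V :
  measurable V ->
  step P pi p (@last_state _ _ S A t.+1 @^-1` V) =
  \int[semidirect P pi]_z p (last_pair z) V.
Proof.
move=> mV; apply: eq_integral => z _; congr (p _ _).
by apply/seteqP; split => x; rewrite xsectionE /= last_state_extend.
Qed.

(** The transition kernel has total mass 1, so an event that ignores the new state keeps its
    probability from before the draw. *)
Lemma step_fst t (P : probability (history S A t) R)
    (pi : R.-pker (history S A t) ~> A) (p : R.-pker (S * A)%type ~> S) B B' :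
  measurable B -> (@extend _ _ S A t) @^-1` B' = B `*` setT ->
  step P pi p B' = semidirect P pi B.
Proof.
move=> mB BB'.
rewrite -(semidirect_fst _ (kprecomp p (@last_pair _ _ S A t)))//.
by rewrite -BB'.
Qed.

(** Reading plain sequences with a default value gives one expression for histories of every
    length. *)
Definition state_input t (h : seq S * seq A) : S * A :=
  (nth point h.1 t, nth point h.2 t).

Lemma measurable_state_input t s : (t < s)%N ->
  measurable_fun setT (fun h : history S A s => state_input t (tval h.1, tval h.2)).
Proof.
move=> ts; apply: measurable_fun_pair => /=.
  rewrite (_ : (fun h => _) = (fun h : history S A s => tnth h.1 (Ordinal (leqW ts)))).
    exact: (measurableT_comp (measurable_tnth _) measurable_fst).
  by apply/funext => h; rewrite (tnth_nth point).
rewrite (_ : (fun h => _) = (fun h : history S A s => tnth h.2 (Ordinal ts))).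
  exact: (measurableT_comp (measurable_tnth _) measurable_snd).
by apply/funext => h; rewrite (tnth_nth point).
Qed.

(** Induction on [s]: when [s = t + 1] the pair has just been completed, and later steps leave
    earlier entries alone. *)
Lemma history_law_state_input T (sys : controlled_system S A T)
    (pi : history_policy R S A T) t s (tT : (t < T)%N) (sT : (s <= T)%N) U :
  (t < s)%N -> measurable U ->
  history_law sys pi sT
    [set h | U (state_input t (tval h.1, tval h.2))] =
  semidirect (history_law sys pi (ltnW tT)) (pi (Ordinal tT))
    (@last_pair _ _ S A t @^-1` U).
Proof.
move=> + mU; elim: s sT => // s IHs sT; rewrite ltnS leq_eqVlt => /predU1P[ts|ts].
  subst s; rewrite /= (bool_irrelevance tT sT); apply: step_fst.
    by rewrite -[X in measurable X]setTI; exact: measurable_funPT.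
  have E (z : history S A t * A * S) :
      state_input t (tval (extend z).1, tval (extend z).2) = last_pair z.1.
    case: z => -[h a] x; rewrite /state_input /last_pair /last_state /=.
    by rewrite (tnth_nth point) !nth_rcons !size_tuple ltnS leqnn ltnn eqxx.
  by apply/seteqP; split => z /=; rewrite E => // -[].
rewrite -(IHs (ltnW sT) ts) /=.
have mB : measurable [set h : history S A s | U (state_input t (tval h.1, tval h.2))].
  by rewrite -[X in measurable X]setTI; exact: measurable_state_input.
rewrite -(semidirect_fst _ (pi (Ordinal sT)) mB); apply: step_fst.
  exact: measurableX.
have E (z : history S A s * A * S) :
    state_input t (tval (extend z).1, tval (extend z).2) =
    state_input t (tval z.1.1.1, tval z.1.1.2).
  by rewrite /state_input /= !nth_rcons !size_tuple ts (leqW ts).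
apply/seteqP; split => z; rewrite /preimage /= E => // -[[Uz _] _].
exact: Uz.
Qed.

End trajectories.
End laws.

(** * Matching policies of the original and augmented systems *)

Section augmentation.
Context {R : realType} {dX dA dW : measure_display}.
Context {X : measurableType dX} {A : measurableType dA}
  {W : measurableType dW}.
Variables (f : {mfun (X * A * W)%type >-> X}) (T : nat).
Variables (p0 : probability X R) (noise : 'I_T -> probability W R).
Variables (Xa : set X) (mXa : measurable Xa) (M : nat) (M_ge1 : (1 <= M)%N).
Local Open Scope ereal_scope.

Let Z := (X * 'I_M.+1)%type.
Let orig := original_system f p0 noise.
Let aug := augmented_system mXa M f p0 noise.

(** * The alarm counter as a function of the history *)

Definition alarms t (h : history X A t) : nat := count (fun x => x \in Xa) h.1.

(** The cap [minn M] keeps the argument of [inord] in range, so its default value is never taken. *)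
Definition augment t (h : history X A t) : Z :=
  (last_state h, inord (minn M (alarms h))).

(** The alarm count is a real-valued sum of indicators, hence measurable; any set of counter values
    pulls back to a countable union of its level sets. *)
Lemma measurable_augment t : measurable_fun setT (@augment t).
Proof.
apply: measurable_fun_pair; first exact: measurable_funPT.
pose s (h : history X A t) : R := (\sum_(i < t.+1) \1_Xa (tnth h.1 i))%R.
have ms : measurable_fun setT s.
  apply: measurable_sum => i.
  have m1 : measurable_fun setT (\1_Xa : X -> R) by exact: measurable_indic.
  apply: (measurableT_comp m1).
  exact: (measurableT_comp (measurable_tnth i) measurable_fst).
have sE h : s h = (alarms h)%:R.
  rewrite /s /alarms -[in RHS](map_tnth_enum h.1) count_map -sum1_count natr_sum.
  rewrite big_enum_cond /= [RHS]big_mkcond /=; apply: eq_bigr => i _.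
  by rewrite indicE; case: (_ \in _).
move=> _ Y _; rewrite setTI.
rewrite (_ : _ @^-1` _ =
    \bigcup_(k in [set k | Y (inord (minn M k))]) (s @^-1` [set k%:R]))%R.
  apply: bigcup_measurable => k _; rewrite -[X in measurable X]setTI.
  by apply: ms => //; exact: measurable_set1.
apply/seteqP; split => h /=.
  by move=> Yh; exists (alarms h) => //=; rewrite sE.
by move=> [k /= Yk]; rewrite sE => /(mulrIn (oner_neq0 R)) ->.
Qed.

Lemma augment_initial x :
  augment (initial_history x : history X A 0) = augmented_initial M mXa x.
Proof.
rewrite /augment /augmented_initial /alarms /initial_count /=.
congr pair; case: ifPn => _ /=; first by rewrite (minn_idPr _).
by rewrite minn0; apply/val_inj; rewrite /= inordK.
Qed.

(** Capping commutes with counting: below [M] the next count is exact, and from [M] on both sides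
    stay at [M]. *)
Lemma next_count_alarms k (x : X) :
  next_count Xa (inord (minn M k) : 'I_M.+1) x = inord (minn M (k + (x \in Xa))).
Proof.
have lt j : (minn M j < M.+1)%N by rewrite ltnS geq_minl.
rewrite /next_count -val_eqE /= inordK//.
have [kM|Mk] := ltnP k M; last first.
  rewrite eqxx; apply/val_inj; rewrite /= inordK//.
  by rewrite (minn_idPl (leq_trans Mk (leq_addr _ _))).
rewrite ltn_eqF//.
by case: (x \in Xa); rewrite ?addn0 ?addn1 (minn_idPr _)// ltnW.
Qed.

(** [augment] intertwines extending the history with the augmented dynamics: given the new state,
    the new counter depends on the past only through its previous value. *)
Lemma augment_extend t (h : history X A t) a x :
  augment (extend (h, a, x)) = (x, next_count Xa (augment h).2 x).
Proof.
rewrite /augment last_state_extend next_count_alarms /alarms /=.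
by rewrite -cats1 count_cat /= addn0.
Qed.

(** Capping at [M] is invisible to thresholds [i <= M]. *)
Lemma leq_final_alarms i (h : history X A T) : (1 <= i <= M)%N ->
  (i <= (augment h).2)%N = (i <= alarm_number Xa h)%N.
Proof.
move=> /andP[i1 iM]; rewrite /augment /= inordK ?ltnS ?geq_minl//.
rewrite leq_min iM /=; congr (_ <= _)%N.
rewrite /alarms /alarm_number -[in LHS](map_tnth_enum h.1) count_map.
by rewrite cardE size_filter count_filter; apply: eq_count => j /=; rewrite andbT.
Qed.

Definition augment_pair t (ha : history X A t * A) : Z * A := (augment ha.1, ha.2).

Lemma measurable_augment_pair t : measurable_fun setT (@augment_pair t).
Proof.
apply: measurable_fun_pair => //.
exact: (measurableT_comp (@measurable_augment t)).
Qed.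

Let augment_mfun t := mfun_of (@measurable_augment t).

(* hpi t is the conditional law of a_t given (x_t, phi_t) under pi. *)
Definition matched (pi : history_policy R X A T) (hpi : markov_policy R Z A T) :=
  forall t (tT : (t < T)%N) U, measurable U ->
  semidirect (history_law orig pi (ltnW tT)) (pi (Ordinal tT))
    (@augment_pair t @^-1` U) =
  semidirect (distribution (history_law orig pi (ltnW tT)) (augment_mfun t))
    (hpi (Ordinal tT)) U.

(** * Equality of laws under matched policies *)

Section matching.
Variables (pi : history_policy R X A T) (hpi : markov_policy R Z A T).
Hypothesis pihpi : matched pi hpi.
Let L t (tT : (t <= T)%N) := history_law orig pi tT.
Let Lhat t (tT : (t <= T)%N) := history_law aug (history_of_markov hpi) tT.

Lemma semidirect_precomp {d} {H : measurableType d} (P : probability H R)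
    (F : {mfun H >-> Z}) (k : R.-pker Z ~> A) U : measurable U ->
  semidirect P (kprecomp k F) [set ha | U (F ha.1, ha.2)] =
  semidirect (distribution P F) k U.
Proof.
move=> mU; rewrite /semidirect ge0_integral_distribution//.
by apply: measurable_fun_xsection_finite_kernel; rewrite inE.
Qed.

(** Equal laws of the augmented state, extended by the same kernel [hpi], give equal joint laws of
    state and input. *)
Lemma matched_pair t (tT : (t < T)%N) U :
  (forall V, measurable V -> L (ltnW tT) (@augment t @^-1` V) =
    Lhat (ltnW tT) (@last_state _ _ Z A t @^-1` V)) ->
  measurable U ->
  semidirect (L (ltnW tT)) (pi (Ordinal tT)) (@augment_pair t @^-1` U) =
  semidirect (Lhat (ltnW tT)) (history_of_markov hpi (Ordinal tT))
    (@last_pair _ _ Z A t @^-1` U).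
Proof.
move=> LL mU; rewrite pihpi//.
rewrite [RHS](semidirect_precomp _ (@last_state _ _ Z A t) _ mU).
by apply: eq_measure_integral => V mV _; exact: LL.
Qed.

(** Induction on [t]: the next augmented state is a function of the current augmented state, the
    input and fresh noise, and [matched_pair] equates the joint laws of the first two. *)
Lemma matched_state t (tT : (t <= T)%N) V : measurable V ->
  L tT (@augment t @^-1` V) = Lhat tT (@last_state _ _ Z A t @^-1` V).
Proof.
elim: t tT V => [|t IHt] tT V mV.
  rewrite /L /Lhat /= /distribution /pushforward /=; congr (p0 _).
  by apply/seteqP; split => x; rewrite /= augment_initial.
rewrite [RHS]step_last//.
(* By [augment_extend], the original transition followed by [augment] is the augmented kernel
   evaluated at the augmented pair. *)
transitivity (\int[semidirect (L (ltnW tT)) (pi (Ordinal tT))]_z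
    noise_kernel (noise (Ordinal tT)) (augmented_step mXa f)
      (augment_pair z) V).
  apply: eq_integral => -[h a] _.
  rewrite /= /kprecomp /noise_kernel /distribution /pushforward /=.
  congr (noise _ _); apply/seteqP; split => w;
  by rewrite xsectionE /= augment_extend.
apply: (@eq_ge0_integral_law R _ _ _ _ _ _ _ _ (@augment_pair t)
  (@last_pair _ _ Z A t)
  (fun z => noise_kernel (noise (Ordinal tT)) (augmented_step mXa f) z V)).
- exact: measurable_augment_pair.
- exact: measurable_funPT.
- by move=> U mU; apply: matched_pair => // ? ?; exact: IHt.
- exact: measurable_kernel.
- by move=> z; exact: measure_ge0.
Qed.

(** Both trajectory laws reduce to joint laws at time [t], where [matched_pair] applies to the event
    that ignores the counter. *)
Lemma matched_stage t (tT : (t < T)%N) U : measurable U ->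
  trajectory_law orig pi
    [set h | U (state_at (widen_ord (leqnSn T) (Ordinal tT)) h,
                input_at (Ordinal tT) h)] =
  trajectory_law aug (history_of_markov hpi)
    [set h | U ((state_at (widen_ord (leqnSn T) (Ordinal tT)) h).1,
                input_at (Ordinal tT) h)].
Proof.
move=> mU.
have mU' : measurable [set z : Z * A | U (z.1.1, z.2)].
  rewrite -[X in measurable X]setTI.
  have mz : measurable_fun setT (fun z : Z * A => (z.1.1, z.2)).
    by apply: measurable_fun_pair => //; exact: measurableT_comp.
  exact: mz.
have := @history_law_state_input _ _ _ _ _ _ orig pi _ _ tT (leqnn T) _ tT mU.
have := @history_law_state_input _ _ _ _ _ _ aug (history_of_markov hpi) _ _
  tT (leqnn T) _ tT mU'.
rewrite -matched_pair//; last by move=> V mV; exact: matched_state.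
move=> E1 E2; transitivity (semidirect (L (ltnW tT)) (pi (Ordinal tT))
  (@last_pair _ _ X A t @^-1` U)).
  by rewrite -E2; congr (history_law _ _ _ _); apply/funext => h /=;
  rewrite /state_at /input_at !(tnth_nth point).
rewrite -[LHS]E1.
by congr (history_law _ _ _ _); apply/funext => h /=;
rewrite /state_at /input_at !(tnth_nth point).
Qed.

Lemma matched_constraint i : (1 <= i <= M)%N ->
  trajectory_law orig pi [set h | (i <= alarm_number Xa h)%N] =
  trajectory_law aug (history_of_markov hpi) [set h | (i <= final_count h)%N].
Proof.
move=> iM.
have mV : measurable [set z : Z | (i <= z.2)%N].
  rewrite (_ : [set _ | _] = setT `*` [set j : 'I_M.+1 | (i <= j)%N]).
    exact: measurableX.
  by apply/seteqP; split => z //= [].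
rewrite -[RHS](matched_state (leqnn T) mV).
by congr (history_law _ _ _ _); apply/funext => h /=; rewrite leq_final_alarms.
Qed.

(** * Equality of the objectives *)

Section objectives.
Variables (g : 'I_T -> {mfun (X * A)%type >-> R}) (gT : {mfun X >-> R}).
Let ghat (t : 'I_T) (z : Z * A) : R := g t (z.1.1, z.2).
Let gThat (z : Z) : R := gT z.1.

(** [c] stands for the positive or the negative part; being nonnegative, it can be integrated
    through laws alone. *)
Let matched_expectation_stage (c : R -> R) (t : 'I_T) :
  measurable_fun setT c -> (forall y, 0 <= c y)%R ->
  'E_(trajectory_law orig pi)[c \o stage_term g t] =
  'E_(trajectory_law aug (history_of_markov hpi))[c \o stage_term ghat t].
Proof.
case: t => t tT mc c0; rewrite !expectation.unlock.
apply: (@eq_ge0_integral_law R _ _ _ _ _ (X * A)%type _ _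
  (fun h => (state_at (widen_ord (leqnSn T) (Ordinal tT)) h,
             input_at (Ordinal tT) h))
  (fun h => ((state_at (widen_ord (leqnSn T) (Ordinal tT)) h).1,
             input_at (Ordinal tT) h))
  (fun y => (c (g (Ordinal tT) y))%:E)).
- apply: measurable_fun_pair.
    exact: (measurableT_comp (measurable_tnth _) measurable_fst).
  exact: (measurableT_comp (measurable_tnth _) measurable_snd).
- apply: measurable_fun_pair.
    apply: (measurableT_comp measurable_fst).
    exact: (measurableT_comp (measurable_tnth _) measurable_fst).
  exact: (measurableT_comp (measurable_tnth _) measurable_snd).
- by move=> U mU; exact: matched_stage.
- apply/measurable_EFinP; apply: (measurableT_comp mc).
  exact: measurable_funPT.
- by move=> y; rewrite lee_fin.
Qed.

Let matched_expectation_final (c : R -> R) :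
  measurable_fun setT c -> (forall y, 0 <= c y)%R ->
  'E_(trajectory_law orig pi)[c \o final_term gT] =
  'E_(trajectory_law aug (history_of_markov hpi))[c \o final_term gThat].
Proof.
move=> mc c0; rewrite !expectation.unlock.
apply: (@eq_ge0_integral_law R _ _ _ _ _ Z _ _ (@augment T)
  (@last_state _ _ Z A T) (fun y => (c (gT y.1))%:E)).
- exact: measurable_augment.
- exact: measurable_funPT.
- by move=> U mU; exact: matched_state.
- apply/measurable_EFinP; apply: (measurableT_comp mc).
  exact: (measurableT_comp (measurable_funPT gT) measurable_fst).
- by move=> y; rewrite lee_fin.
Qed.

(** Positive and negative parts have equal expectations term by term, so both the well-definedness
    and the value carry over. *)
Lemma matched_objective :
  objective_well_defined g gT (trajectory_law orig pi) ->
  objective g gT (trajectory_law orig pi) =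
  objective ghat gThat (trajectory_law aug (history_of_markov hpi)).
Proof.
have mp : measurable_fun setT (fun y : R => Num.max y 0)%R.
  exact: measurable_maxr.
have mn : measurable_fun setT (fun y : R => Num.max (- y) 0)%R.
  exact: measurable_maxr.
have p0' (y : R) : (0 <= Num.max y 0)%R by rewrite le_max lexx orbT.
have n0' (y : R) : (0 <= Num.max (- y) 0)%R by rewrite le_max lexx orbT.
have Ep : \sum_(t < T) 'E_(trajectory_law orig pi)[(stage_term g t)^\+] +
      'E_(trajectory_law orig pi)[(final_term gT)^\+] =
    \sum_(t < T) 'E_(trajectory_law aug (history_of_markov hpi))
      [(stage_term ghat t)^\+] +
      'E_(trajectory_law aug (history_of_markov hpi))[(final_term gThat)^\+].
  congr (_ + _); last exact: matched_expectation_final mp p0'.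
  by apply: eq_bigr => t _; exact: matched_expectation_stage t mp p0'.
have En : \sum_(t < T) 'E_(trajectory_law orig pi)[(stage_term g t)^\-] +
      'E_(trajectory_law orig pi)[(final_term gT)^\-] =
    \sum_(t < T) 'E_(trajectory_law aug (history_of_markov hpi))
      [(stage_term ghat t)^\-] +
      'E_(trajectory_law aug (history_of_markov hpi))[(final_term gThat)^\-].
  congr (_ + _); last exact: matched_expectation_final mn n0'.
  by apply: eq_bigr => t _; exact: matched_expectation_stage t mn n0'.
rewrite /objective /objective_well_defined => wd.
rewrite !expectation_quasi_sum//.
- by rewrite Ep En.
- move=> t; apply: (measurableT_comp (measurable_funPT (g t))).
  apply: measurable_fun_pair; last first.
    exact: (measurableT_comp (measurable_tnth _) measurable_snd).
  apply: (measurableT_comp measurable_fst).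
  exact: (measurableT_comp (measurable_tnth _) measurable_fst).
- apply: (measurableT_comp (measurable_funPT gT)).
  apply: (measurableT_comp measurable_fst).
  exact: (measurableT_comp (measurable_tnth _) measurable_fst).
- by rewrite -Ep -En.
- move=> t; apply: (measurableT_comp (measurable_funPT (g t))).
  apply: measurable_fun_pair; last first.
    exact: (measurableT_comp (measurable_tnth _) measurable_snd).
  exact: (measurableT_comp (measurable_tnth _) measurable_fst).
- apply: (measurableT_comp (measurable_funPT gT)).
  exact: (measurableT_comp (measurable_tnth _) measurable_fst).
Qed.

End objectives.
End matching.

(** * Existence of matching policies *)

Lemma matched_history_policy (hpi : markov_policy R Z A T) :
  exists pi, matched pi hpi.
Proof.
(* The policy reconstructs the augmented state from the history and passes it to [hpi]. *)
exists (fun t => kprecomp (hpi t) (augment_mfun t)) => t tT U mU.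
exact: (semidirect_precomp _ (augment_mfun t)).
Qed.

(** Disintegrates the joint law of augmented state and input at each time. These laws involve [pi]
    alone, so the kernels can be chosen separately for every [t]. *)
Lemma matched_markov_policy (pi : history_policy R X A T) :
  @randomizable R _ A -> exists hpi, matched pi hpi.
Proof.
move=> rA.
have disint (t : 'I_T) : exists k : R.-pker Z ~> A, forall U, measurable U ->
    semidirect (history_law orig pi (ltnW (ltn_ord t))) (pi t)
      (@augment_pair t @^-1` U) =
    semidirect (distribution (history_law orig pi (ltnW (ltn_ord t)))
      (augment_mfun t)) k U.
  have [C mC|k kE] := @randomizable_disintegration R _ _ A Z
    (distribution (history_law orig pi (ltnW (ltn_ord t))) (augment_mfun t))
    (distribution (semidirect (history_law orig pi (ltnW (ltn_ord t))) (pi t))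
      (mfun_of (@measurable_augment_pair t))) rA; last by exists k.
  have mB : measurable (@augment t @^-1` C).
    by rewrite -[X in measurable X]setTI; exact: measurable_augment.
  rewrite -[RHS](semidirect_fst (history_law orig pi (ltnW (ltn_ord t))) (pi t) mB).
  by congr (semidirect _ _ _); apply/seteqP; split => -[h a].
have [hpi hpiE] := choice disint.
exists hpi => t tT U mU.
have := hpiE (Ordinal tT) U mU.
by rewrite (bool_irrelevance (ltn_ord (Ordinal tT)) tT).
Qed.

End augmentation.

(** * Equality of the optimal values *)

Unset Implicit Arguments.

Theorem theorem2 (R : realType) (n m l : nat)
    (X : borelSet R n) (A : borelSet R m) (W : borelSet R l)
    (T : nat) (T_ge1 : (1 <= T)%N)
    (f : {mfun (X * A * W)%type >-> X})
    (p0 : probability X R) (noise : 'I_T -> probability W R)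
    (Xa : set X) (mXa : measurable Xa)
    (g : 'I_T -> {mfun (X * A)%type >-> R}) (gT : {mfun X >-> R})
    (M : nat) (M_ge1 : (1 <= M)%N)
    (Delta : nat -> R)
    (Delta_ge0 : forall i : nat, (1 <= i <= M)%N -> 0 <= Delta i) :
  let P (pi : history_policy R X A T) :=
    trajectory_law (original_system f p0 noise) pi in
  let Phat (pi : markov_policy R (X * 'I_M.+1)%type A T) :=
    trajectory_law (augmented_system mXa M f p0 noise)
      (history_of_markov pi) in
  let ghat (t : 'I_T) (z : X * 'I_M.+1 * A) : R := g t (z.1.1, z.2) in
  let gThat (z : X * 'I_M.+1) : R := gT z.1 in
  (forall pi, objective_well_defined g gT (P pi)) ->
  (forall pi, objective_well_defined ghat gThat (Phat pi)) ->
  ereal_sup [set objective g gT (P pi) | pi in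
    [set pi | forall i : nat, (1 <= i <= M)%N ->
       (P pi [set h | (i <= alarm_number Xa h)%N] <= (Delta i)%:E)%E]]
  =
  ereal_sup [set objective ghat gThat (Phat pi) | pi in
    [set pi | forall i : nat, (1 <= i <= M)%N ->
       (Phat pi [set h | (i <= final_count h)%N]
          <= (Delta i)%:E)%E]].
Proof.
(* The sets of values attained by feasible policies coincide, which also covers the case where both
   are empty. *)
move=> P Phat ghat gThat wd _; congr ereal_sup.
apply/seteqP; split => _ [pol cpol <-].
- have [hpi pihpi] := matched_markov_policy f p0 noise mXa M pol
    (@randomizable_borel R m A).
  exists hpi; last by rewrite /P (matched_objective M_ge1 pihpi).
  by move=> i iM; rewrite /Phat -(matched_constraint M_ge1 pihpi iM); exact: cpol.
- have [pi pihpi] := matched_history_policy f p0 noise mXa pol.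
  exists pi; last by rewrite /P (matched_objective M_ge1 pihpi).
  by move=> i iM; rewrite /P (matched_constraint M_ge1 pihpi iM); exact: cpol.
Qed.
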